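(* Let $m\ge 2$, and let $a_{m,n}$ denote the density of $B_m(A_n)$. For $n=2$, $$a_{m+1,n} \leq 3\, a_{m,n}.$$ For $n=3$, $$a_{m+1,n} \leq 9\, a_{m,n}.$$ For $n\geq 4$, $$a_{m+1,n} \leq \frac{n^3+11n}{6}\,a_{m,n}.$$
   Context: The ground field is $\mathbb{C}$ (or any field of characteristic zero in its place). $A=A_n$ is the free unital associative algebra on $x_1,\ldots,x_n$, graded by total degree with $\deg x_i=1$. For subspaces $P,Q$, $[P,Q]$ is the span of commutators. Put $L_1=A$, $L_{m+1}=[A,L_m]$, $B_m(A_n)=L_m/L_{m+1}$, with the induced grading; $B_m(A_n)[d]$ is its degree-$d$ part. It is known that for $m\ge2$ the function $d\mapsto\dim B_m(A_n)[d]$ agrees, for $d\gg0$, with a polynomial $p_{mn}(d)$ of degree $n-1$ (the Hilbert polynomial). The density $a_{m,n}$ is the leading coefficient of $p_{mn}$ multiplied by $(n-1)!$. *)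

(* Defs.v *)
From HB Require Import structures.
From mathcomp Require Import all_boot all_order all_algebra.
From mathcomp.multinomials Require Export monalg.

Set Implicit Arguments.
Unset Strict Implicit.
Unset Printing Implicit Defensive.

Import Order.TTheory GRing.Theory Num.Theory.
Local Open Scope ring_scope.

Section LinearAlgebra.
Variables (F : fieldType) (V : lmodType F).

Definition linear_span (S : V -> Prop) : V -> Prop := fun x =>
  exists (k : nat) (c : 'I_k -> F) (v : 'I_k -> V),
    (forall i, S (v i)) /\ x = \sum_(i < k) c i *: v i.

(* For subspaces P and Q: the image of P in V/Q, that is P/(P \cap Q), has a
   basis of k elements, the classes of the v i. *)
Definition dim_mod (P Q : V -> Prop) (k : nat) : Prop :=
  exists v : 'I_k -> V,
    [/\ forall i, P (v i),
        forall c : 'I_k -> F, Q (\sum_(i < k) c i *: v i) -> forall i, c i = 0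
      & forall x, P x -> exists c : 'I_k -> F, Q (x - \sum_(i < k) c i *: v i)].

End LinearAlgebra.


Section FreeAlgebra.
Variables (F : fieldType) (n : nat).
(* The free algebra on x_0, ..., x_(n-1), as the monoid algebra of the free
   monoid of words; x_i is << fmu i >>. *)
Local Notation A := {malg F[{fmonom 'I_n}]}.

Definition homogeneous (d : nat) (a : A) : Prop :=
  forall w : {fmonom 'I_n}, a@_w != 0 -> fdeg w = d.

Definition bracket (P Q : A -> Prop) : A -> Prop :=
  linear_span (fun x => exists a b : A, [/\ P a, Q b & x = a * b - b * a]).

(* Indexed from 1; the value at 0 is irrelevant. *)
Fixpoint lcs (m : nat) : A -> Prop :=
  match m with
  | 0 | 1 => fun _ => True
  | m'.+1 => bracket (fun _ => True) (lcs m')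
  end.

(* dim B_m(A_n)[d] = k: the degree-d part of L_m / L_{m+1} is the image of the
   homogeneous elements of degree d in L_m. *)
Definition dim_B (m d k : nat) : Prop :=
  dim_mod (fun a => lcs m a /\ homogeneous d a) (lcs m.+1) k.

Definition hilbert_poly (m : nat) (p : {poly rat}) : Prop :=
  (* degree n - 1 *)
  size p = n /\
  exists d0 : nat, forall d : nat, (d0 <= d)%N ->
    exists2 k : nat, dim_B m d k & p.[d%:R] = k%:R.

Definition is_density (m : nat) (a : rat) : Prop :=
  exists2 p : {poly rat}, hilbert_poly m p & a = lead_coef p * (n.-1)`!%:R.

End FreeAlgebra.

(* Main.v *)
Require Import Defs.
From HB Require Import structures.
From mathcomp Require Import all_boot all_order all_algebra.
From mathcomp.multinomials Require Import monalg.
From mathcomp Require Import zify.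
Import Order.TTheory GRing.Theory Num.Theory.
Local Open Scope ring_scope.

(* If e lies in L_k, bracketing b and then a with [e, a^2] = [e, a] a + a [e, a]
   shows that [a, [b, a] [e, a] + [e, a] [b, a]] lies in L_(k+3), and this means
     [a^3, [b, e]] = 3 [a^2, [a b, e]] - 3 [a, [a^2 b, e]]   mod L_(k+3).
   Polarize in a, and call p good when [p, L_m] is contained in a given space W
   that contains L_(m+2). Good elements contain L_2, hence are invariant under
   cyclic rotation of words, and if p, q, r, p q, p r, q r are good, so is
   p q r + p r q. So, modulo good elements, exchanging two adjacent blocks of a
   word changes its sign. A word of length at least 4 is then good, because the
   exchange of a block of two letters with a letter is also a product of two
   exchanges of letters. Taking for W the sum of L_(m+2) and the [u, L_m], where
   u is a product of at most 3 distinct generators in increasing order, and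
   checking that the squares of the generators are good, one gets that every
   element is good. Hence dim B_(m+1)[d] <= sum_u dim B_m[d - deg u], and the
   density is multiplied by at most n + 'C(n, 2) + 'C(n, 3). *)

Set Implicit Arguments.
Unset Strict Implicit.
Unset Printing Implicit Defensive.

(** * Identities in noncommutative rings *)

(** Reified expressions: an identity valid in every ring is checked by expanding it into words and
    comparing multisets of words by computation. *)
Inductive ncpoly :=
  | NCvar of nat | NCadd of ncpoly & ncpoly | NCopp of ncpoly
  | NCmul of ncpoly & ncpoly | NCmuln of ncpoly & nat.

Fixpoint nceval (R : pzRingType) (env : seq R) (t : ncpoly) : R :=
  match t with
  | NCvar i => env`_i
  | NCadd t1 t2 => nceval env t1 + nceval env t2
  | NCopp t1 => - nceval env t1
  | NCmul t1 t2 => nceval env t1 * nceval env t2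
  | NCmuln t1 k => nceval env t1 *+ k
  end.

(* The words with coefficient 1 and those with coefficient -1, repeated
   according to their multiplicity. *)
Fixpoint ncwords (t : ncpoly) : seq (seq nat) * seq (seq nat) :=
  match t with
  | NCvar i => ([:: [:: i]], [::])
  | NCadd t1 t2 => let (p1, n1) := ncwords t1 in
      let (p2, n2) := ncwords t2 in (p1 ++ p2, n1 ++ n2)
  | NCopp t1 => let (p1, n1) := ncwords t1 in (n1, p1)
  | NCmul t1 t2 => let (p1, n1) := ncwords t1 in
      let (p2, n2) := ncwords t2 in
      ([seq u ++ v | u <- p1, v <- p2] ++ [seq u ++ v | u <- n1, v <- n2],
       [seq u ++ v | u <- p1, v <- n2] ++ [seq u ++ v | u <- n1, v <- p2])
  | NCmuln t1 k => let (p1, n1) := ncwords t1 in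
      (flatten (nseq k p1), flatten (nseq k n1))
  end.

Section Noncommutative.
Variables (R : pzRingType) (env : seq R).

Definition ncword (w : seq nat) : R := \prod_(i <- w) env`_i.
Definition ncsum (s : seq (seq nat)) : R := \sum_(w <- s) ncword w.

Lemma ncsum_cat s1 s2 : ncsum (s1 ++ s2) = ncsum s1 + ncsum s2.
Proof. exact: big_cat. Qed.

Lemma ncsum_mul s1 s2 :
  ncsum [seq u ++ v | u <- s1, v <- s2] = ncsum s1 * ncsum s2.
Proof.
rewrite /ncsum big_distrlr big_allpairs_dep /=; apply: eq_bigr => u _.
by apply: eq_bigr => v _; rewrite /ncword big_cat.
Qed.

Lemma ncsum_nseq k s : ncsum (flatten (nseq k s)) = ncsum s *+ k.
Proof.
by elim: k => [|k IH]; rewrite ?mulr0n /= /ncsum ?big_nil // big_cat mulrS -IH.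
Qed.

Lemma ncevalE t : nceval env t = ncsum (ncwords t).1 - ncsum (ncwords t).2.
Proof.
elim: t => [i|t1 IH1 t2 IH2|t IH|t1 IH1 t2 IH2|t IH k] /=.
- by rewrite /ncsum big_nil big_seq1 /ncword big_seq1 subr0.
- rewrite IH1 IH2; case: (ncwords t1) (ncwords t2) => p1 n1 [p2 n2] /=.
  by rewrite !ncsum_cat opprD addrACA.
- by rewrite IH; case: (ncwords t) => p1 n1 /=; rewrite opprB.
- rewrite IH1 IH2; case: (ncwords t1) (ncwords t2) => p1 n1 [p2 n2] /=.
  by rewrite !ncsum_cat !ncsum_mul mulrBl !mulrBr opprB opprD addrACA.
- by rewrite IH; case: (ncwords t) => p1 n1 /=; rewrite !ncsum_nseq mulrnBl.
Qed.

Lemma nceval_eq t1 t2 :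
    (let w := ncwords (NCadd t1 (NCopp t2)) in perm_eq w.1 w.2) ->
  nceval env t1 = nceval env t2.
Proof.
move=> eq_w; apply/eqP; rewrite -subr_eq0.
rewrite -[_ - _]/(nceval env (NCadd t1 (NCopp t2))) ncevalE subr_eq0.
by apply/eqP; apply: perm_big.
Qed.

End Noncommutative.

Ltac nc_index x env :=
  lazymatch env with
  | x :: _ => constr:(0%N)
  | _ :: ?env' => let i := nc_index x env' in constr:(S i)
  end.

Ltac nc_quote env t :=
  lazymatch t with
  | @GRing.add _ ?a ?b => let a' := nc_quote env a in
      let b' := nc_quote env b in constr:(NCadd a' b')
  | @GRing.opp _ ?a => let a' := nc_quote env a in constr:(NCopp a')
  | @GRing.mul _ ?a ?b => let a' := nc_quote env a in
      let b' := nc_quote env b in constr:(NCmul a' b')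
  | @GRing.natmul _ ?a ?k => let a' := nc_quote env a in constr:(NCmuln a' k)
  | _ => let i := nc_index t env in constr:(NCvar i)
  end.

Ltac ncring env :=
  lazymatch goal with
  | |- @eq _ ?a ?b => let a' := nc_quote env a in let b' := nc_quote env b in
      refine (@nceval_eq _ env a' b' _); vm_compute; reflexivity
  end.

(** Locked so that [ad a] stays opaque and can carry a linear structure; [adE] opens it before each
    call of [ncring]. *)
HB.lock Definition ad (R : pzRingType) (a b : R) : R := a * b - b * a.

Lemma adE (R : pzRingType) (a b : R) : ad a b = a * b - b * a.
Proof. by rewrite ad.unlock. Qed.

Definition sum6 (V : zmodType) (T : Type) (f : T -> T -> T -> V) p q r : V :=
  f p q r + f p r q + f q p r + f q r p + f r p q + f r q p.

Lemma perm_pair (T : eqType) (s : seq T) i j :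
  perm_eq s [:: i; j] -> s = [:: i; j] \/ s = [:: j; i].
Proof.
move=> eq_s; have: size s = 2 by rewrite (perm_size eq_s).
case: s eq_s => [|a [|b []]] // eq_s _.
have: a \in [:: i; j] by rewrite -(perm_mem eq_s) mem_head.
rewrite !inE => /orP[] /eqP eq_a; rewrite {a}eq_a in eq_s *; [left|right].
  by move: eq_s; rewrite perm_cons => /perm_small_eq -> //.
move: eq_s; rewrite perm_sym -[X in perm_eq X]/([:: i] ++ [:: j]) perm_catC.
by rewrite perm_cons perm_sym => /perm_small_eq -> //.
Qed.

Lemma sum6D (V : zmodType) (T : Type) (f g : T -> T -> T -> V) p q r :
  sum6 (fun u v w => f u v w + g u v w) p q r = sum6 f p q r + sum6 g p q r.
Proof. by rewrite /sum6; do 5!(rewrite [RHS]addrACA; congr (_ + _)). Qed.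

(** Polarized form of the identity for [a^3, [b, e]]. Every term on the right has at least three
    nested brackets around e; doubling keeps the coefficients integral. *)
Lemma ad_sym3 (R : pzRingType) (p q r b e : R) :
  sum6 (fun u v w => ad (u * v * w) (ad b e) - ad (u * v) (ad (w * b) e) *+ 3
    + ad u (ad (v * w * b) e) *+ 3) p q r *+ 2 =
  sum6 (fun u v w => ad u (ad v (ad w (ad b e))) *+ 2
    + ad u (ad b (ad e (v * w))) *+ 3 - ad (u * v) (ad b (ad e w)) *+ 3
    + ad u (ad (ad v e) (ad w b)) *+ 3) p q r.
Proof. by rewrite /sum6 !adE; ncring [:: p; q; r; b; e]. Qed.

(** * Subspaces and the lower central series *)

Section Subspaces.
Variables (F : fieldType) (V : lmodType F).
Implicit Types (P S T : V -> Prop) (x y : V).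

Definition subspace S := S 0 /\ forall c x y, S x -> S y -> S (c *: x + y).

Section Closure.
Variables (S : V -> Prop) (subS : subspace S).

Lemma subspace0 : S 0. Proof. by case: subS. Qed.

Lemma subspaceD x y : S x -> S y -> S (x + y).
Proof. by case: subS => _ lin Sx Sy; rewrite -[x]scale1r; apply: lin. Qed.

Lemma subspaceZ c x : S x -> S (c *: x).
Proof. by case: subS => S0 lin Sx; rewrite -[_ *: _]addr0; apply: lin. Qed.

Lemma subspaceN x : S x -> S (- x).
Proof. by rewrite -scaleN1r; apply: subspaceZ. Qed.

Lemma subspaceB x y : S x -> S y -> S (x - y).
Proof. by move=> Sx Sy; apply/subspaceD/subspaceN. Qed.

Lemma subspaceMn x k : S x -> S (x *+ k).
Proof. by rewrite -scaler_nat; apply: subspaceZ. Qed.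

Lemma subspace_sum (I : Type) (r : seq I) (p : pred I) (f : I -> V) :
  (forall i, p i -> S (f i)) -> S (\sum_(i <- r | p i) f i).
Proof. by move=> Sf; apply: big_ind => //;
  [exact: subspace0|exact: subspaceD]. Qed.

Lemma subspaceBK x y : S (x - y) -> S y -> S x.
Proof. by move=> Sxy Sy; rewrite -[x](subrK y); apply: subspaceD. Qed.

Lemma subspaceKB x y : S (x - y) -> S x -> S y.
Proof. by move=> Sxy Sx; rewrite -[y](subKr x); apply: subspaceB. Qed.

(** Division by k + 1: an argument 1, 2 or 8 at a use stands for division by 2, 3 or 9. *)
Lemma subspaceMnK x k : [pchar F] =i pred0 -> S (x *+ k.+1) -> S x.
Proof.
move=> charF0 Skx; rewrite -[x](@scalerK _ _ k.+1%:R) ?scaler_nat.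
  exact: subspaceZ.
by move/pcharf0P: charF0 => ->.
Qed.

End Closure.

Lemma linear_span_incl P x : P x -> linear_span P x.
Proof.
by move=> Px; exists 1%N, (fun=> 1), (fun=> x); rewrite big_ord1 scale1r.
Qed.

Lemma linear_span_subspace P : subspace (linear_span P).
Proof.
split=> [|c x y [k [a [v [Pv ->]]]] [l [b [w [Pw ->]]]]].
  by exists 0%N, (fun=> 0), (fun=> 0); rewrite big_ord0; split=> // -[].
exists (k + l)%N, (fun i => match split i with inl j => c * a j | inr j =>
  b j end).
exists (fun i => match split i with inl j => v j | inr j => w j end).
split=> [i|]; first by case: (split i).
rewrite big_split_ord /= scaler_sumr; congr (_ + _); apply: eq_bigr => i _.
  by rewrite (unsplitK (inl i)) scalerA.
by rewrite (unsplitK (inr i)).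
Qed.

Lemma linear_span_min P S x :
  subspace S -> (forall y, P y -> S y) -> linear_span P x -> S x.
Proof.
move=> subS PS [k [c [v [Pv ->]]]].
apply: (subspace_sum subS) => i _; apply: (subspaceZ subS).
exact/PS/Pv.
Qed.

End Subspaces.

Section Commutators.
Variables (F : fieldType) (A : algType F).
Implicit Types a b x y : A.

Lemma adC a b : ad a b = - ad b a. Proof. by rewrite !adE opprB. Qed.

Fact ad_is_linear a : linear (ad a).
Proof.
move=> c x y; rewrite !adE mulrDr mulrDl -scalerAr -scalerAl scalerBr.
by rewrite opprD addrACA.
Qed.

HB.instance Definition _ a := GRing.isLinear.Build F A A *:%R (ad a)
  (ad_is_linear a).

Lemma ad_linearl c a b x : ad (c *: a + b : A) x = c *: ad a x + ad b x.
Proof. by rewrite [LHS]adC (linearP (ad x)) opprD -scalerN -!adC. Qed.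

Lemma adDl a b x : ad (a + b) x = ad a x + ad b x.
Proof. by rewrite ![ad _ x]adC (raddfD (ad x)) opprD. Qed.

Lemma adNl a x : ad (- a) x = - ad a x.
Proof. by rewrite ![ad _ x]adC (raddfN (ad x)). Qed.

Lemma adBl a b x : ad (a - b) x = ad a x - ad b x.
Proof. by rewrite adDl adNl. Qed.

Lemma ad_jacobi a b x : ad (ad a b) x = ad a (ad b x) - ad b (ad a x).
Proof. by rewrite !adE; ncring [:: a; b; x]. Qed.

End Commutators.

Section LowerCentralSeries.
Variables (F : fieldType) (A : algType F).
Implicit Types (a b e g l x y : A).

(** The series over an arbitrary algebra, phrased with [ad]; [lcsE] matches it with [lcs] on the
    free algebra. *)
Fixpoint alg_lcs (m : nat) : A -> Prop :=
  match m with
  | 0 | 1 => fun _ => True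
  | m'.+1 => linear_span (fun x => exists a b, alg_lcs m' b /\ x = ad a b)
  end.
Local Notation lcs := alg_lcs.

Lemma lcs_subspace m : subspace (lcs m).
Proof. by case: m => [|[|m]] //=; apply: linear_span_subspace. Qed.

Lemma lcs_ad m a b : (0 < m)%N -> lcs m b -> lcs m.+1 (ad a b).
Proof.
by case: m => // m _ Lb; apply: linear_span_incl; exists a, b.
Qed.

Lemma lcs_min m (S : A -> Prop) x : (0 < m)%N -> subspace S ->
  (forall a b, lcs m b -> S (ad a b)) -> lcs m.+1 x -> S x.
Proof.
case: m => // m _ subS adS; apply: linear_span_min => // y [a [b [Lb ->]]].
exact: adS.
Qed.

#[local] Arguments alg_lcs : simpl never.

Lemma lcsW m x : (0 < m)%N -> lcs m.+1 x -> lcs m x.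
Proof.
case: m => // m _; elim: m x => // m IH x.
apply: lcs_min => //; first exact: lcs_subspace.
by move=> a b /IH Lb; apply: lcs_ad.
Qed.

(** By the Jacobi identity, bracketing with a commutator counts as two brackets. *)
Lemma lcs2_ad m x l : (0 < m)%N -> lcs 2 x -> lcs m l -> lcs m.+2 (ad x l).
Proof.
move=> m_gt0 L2x Ll; move: L2x; have subL := lcs_subspace m.+2.
apply: (@lcs_min 1 (fun y => lcs m.+2 (ad y l))) => // [|a b _].
  split=> [|c y z Ly Lz]; first by rewrite adE mul0r mulr0 subrr; case: subL.
  by rewrite ad_linearl; case: subL => _; apply.
by rewrite ad_jacobi; apply: subspaceB => //; do 2!apply: lcs_ad => //.
Qed.

Lemma ad_sym3_lcs m p q r b e : [pchar F] =i pred0 -> (0 < m)%N -> lcs m e ->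
  lcs m.+3 (sum6 (fun u v w => ad (u * v * w) (ad b e)
    - ad (u * v) (ad (w * b) e) *+ 3 + ad u (ad (v * w * b) e) *+ 3) p q r).
Proof.
move=> charF0 m_gt0 Le; have subL := lcs_subspace m.+3.
apply: (@subspaceMnK _ _ _ subL _ 1 charF0).
rewrite ad_sym3.
have Ladl a : lcs m.+1 (ad e a).
  by rewrite adC; apply: (subspaceN (lcs_subspace _)); apply: lcs_ad.
have Lterm u v w : lcs m.+3 (ad u (ad v (ad w (ad b e))) *+ 2
    + ad u (ad b (ad e (v * w))) *+ 3 - ad (u * v) (ad b (ad e w)) *+ 3
    + ad u (ad (ad v e) (ad w b)) *+ 3).
  apply: (subspaceD subL); last first.
    apply: (subspaceMn subL); rewrite [ad (ad v e) _]adC (raddfN (ad u)).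
    by apply: (subspaceN subL); do 3!apply: lcs_ad => //.
  by apply: (subspaceB subL); [apply: (subspaceD subL)|];
    apply: (subspaceMn subL); 
    [apply: lcsW => //; do 4!apply: lcs_ad => //|
     do 2!apply: lcs_ad => //|do 2!apply: lcs_ad => //].
by rewrite /sum6; do 5!apply: (subspaceD subL) => //.
Qed.

Section Generators.
Variables (I : finType) (X : I -> A).
Implicit Types (i j : I) (s t : seq I).

Definition xword s : A := \prod_(i <- s) X i.

Lemma xword_cat s t : xword (s ++ t) = xword s * xword t.
Proof. exact: big_cat. Qed.

Lemma xword1 i : xword [:: i] = X i.
Proof. exact: big_seq1. Qed.

Hypothesis xword_span : forall (S : A -> Prop) a,
  subspace S -> (forall s, S (xword s)) -> S a.

Lemma lcs2_rot s t : lcs 2 (xword (s ++ t) - xword (t ++ s)).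
Proof. by rewrite !xword_cat -adE; apply: lcs_ad. Qed.

(* [x1 ... xk, a] = sum_i [xi, x(i+1) ... xk a x1 ... x(i-1)] *)
Lemma lcs2E x : lcs 2 x -> exists b : I -> A,
  x = \sum_i ad (X i) (b i).
Proof.
pose S y := exists b : I -> A, y = \sum_i ad (X i) (b i).
have subS : subspace S.
  split=> [|c y z [b ->] [b' ->]].
    by exists (fun=> 0); rewrite big1 // => i _; rewrite adE mul0r mulr0 subrr.
  exists (fun i => c *: b i + b' i); rewrite scaler_sumr -big_split /=.
  by apply: eq_bigr => i _; rewrite (linearP (ad _)).
apply: (@lcs_min 1 S) => // a b _; move: b.
apply: (@xword_span (fun a => forall b, S (ad a b)) a) => [|s].
  split=> [b|c y z Sy Sz b]; first by rewrite adE mul0r mulr0 subrr; case: subS.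
  by rewrite ad_linearl; case: subS => _; apply.
elim: s => [|i s IH] b.
  rewrite /xword big_nil adE mul1r mulr1 subrr; exact: subspace0 subS.
rewrite -cat1s xword_cat xword1.
rewrite (_ : ad _ b = ad (X i) (xword s * b)
                      + ad (xword s) (b * X i)); last first.
  by rewrite !adE; ncring [:: X i; xword s; b].
apply: (subspaceD subS) => //.
exists (fun j => if j == i then xword s * b else 0).
rewrite (bigD1 i) //= eqxx big1 ?addr0 // => j /negPf->.
by rewrite adE mulr0 mul0r subrr.
Qed.

End Generators.

End LowerCentralSeries.

#[local] Arguments alg_lcs : simpl never.

(** * Generation of the lower central series *)

Section Generation.
Variables (F : fieldType) (A : algType F) (I : finType) (X : I -> A).
Hypothesis charF0 : [pchar F] =i pred0.
Hypothesis xword_span : forall (S : A -> Prop) a,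
  subspace S -> (forall s, S (xword X s)) -> S a.
Local Notation lcs := (@alg_lcs F A).
Local Notation xword := (xword X).
Implicit Types (a b e g l p q r x y : A) (i j k : I).
Implicit Types (s t : seq I) (S : {set I}).

Definition short S := (0 < #|S| <= 3)%N.

(** The space W of the opening comment. A product u is encoded by the set of its generators, which
    [enum] lists in increasing order. *)
Definition genspan m x := exists g : {set I} -> A, (forall S, lcs m (g S)) /\
  lcs m.+2 (x - \sum_(S | short S) ad (xword (enum S)) (g S)).

(** The good elements of the opening comment. *)
Definition reaches m a := forall l, lcs m l -> genspan m (ad a l).

Lemma genspan_subspace m : subspace (genspan m).
Proof.
have [sub0 sub2] := (lcs_subspace A m, lcs_subspace A m.+2).
split=> [|c x y [g [Lg Lx]] [h [Lh Ly]]].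
  exists (fun=> 0); split=> [S|]; first exact: subspace0 sub0.
  by rewrite big1 ?subr0 => [|S _]; [exact: subspace0 sub2|rewrite adE mul0r
    mulr0 subrr].
exists (fun S => c *: g S + h S); split=> [S|]; first by case: sub0 => _; apply.
rewrite [X in lcs _ X](_ : _ =
  c *: (x - \sum_(S | short S) ad (xword (enum S)) (g S))
  + (y - \sum_(S | short S) ad (xword (enum S)) (h S)));
    first by case: sub2 => _; apply.
rewrite scalerBr addrACA -opprD scaler_sumr -big_split /=; congr (_ - _).
by apply: eq_bigr => S _; rewrite (linearP (ad _)).
Qed.

Lemma lcs_genspan m x : lcs m.+2 x -> genspan m x.
Proof.
move=> Lx; exists (fun=> 0); split=> [S|];
  first exact: subspace0 (lcs_subspace _ _).
by rewrite big1 ?subr0 // => S _; rewrite adE mul0r mulr0 subrr.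
Qed.

Lemma genspan_ad m S l : short S -> lcs m l ->
  genspan m (ad (xword (enum S)) l).
Proof.
move=> shS Ll; have L0 d : lcs d 0 by apply: subspace0 (lcs_subspace _ _).
exists (fun T => if T == S then l else 0); split=> [T|]; first by case: eqP.
rewrite (bigD1 S) //= eqxx big1 ?addr0 ?subrr // => T /andP[_ /negPf->].
by rewrite adE mul0r mulr0 subrr.
Qed.

Lemma reaches_subspace m : subspace (reaches m).
Proof.
have [G0 GP] := genspan_subspace m; split=> [l _|c a b Ra Rb l Ll].
  by rewrite adE mul0r mulr0 subrr.
by rewrite ad_linearl; apply: GP; [apply: Ra|apply: Rb].
Qed.

Section Level.
Variables (m : nat) (m_gt0 : (0 < m)%N).
(** The index is shifted because elements of L_(m+1) are combinations of [b, e] with e in L_m, the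
    form to which [ad_sym3_lcs] applies. This is where the bound 2 on the level comes from. *)
Local Notation reaches := (reaches m.+1).
Local Notation genspan := (genspan m.+1).

Let subG : subspace genspan := genspan_subspace m.+1.
Let subR : subspace reaches := reaches_subspace m.+1.

Lemma reaches_lcs2 a : lcs 2 a -> reaches a.
Proof. by move=> La l Ll; apply/lcs_genspan/lcs2_ad. Qed.

Lemma reaches_ad a b : reaches (ad a b).
Proof. by apply/reaches_lcs2/lcs_ad. Qed.

Lemma reaches_mulC a b : reaches (a * b) -> reaches (b * a).
Proof.
move=> Rab; apply: (subspaceBK subR) Rab.
by rewrite -adE; apply: reaches_ad.
Qed.

(** By linearity l = [b, e]. In [ad_sym3_lcs] all terms other than the cubic ones are brackets of a
    good u or u v with an element of L_(m+1), so they lie in the span. *)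
Lemma reaches_sum6 p q r : reaches p -> reaches q -> reaches r ->
    reaches (p * q) -> reaches (p * r) -> reaches (q * r) ->
  reaches (sum6 (fun u v w => u * v * w) p q r).
Proof.
move=> Rp Rq Rr Rpq Rpr Rqr l.
have [Rqp Rrp Rrq] : [/\ reaches (q * p), reaches (r * p) & reaches (r * q)].
  by split; apply: reaches_mulC.
set T := sum6 _ p q r; apply: (@lcs_min _ _ m (fun l => genspan (ad T l))) =>
  // [|b e Le].
  split=> [|c x y Gx Gy]; first by rewrite (raddf0 (ad _));
    apply: subspace0 subG.
  by rewrite (linearP (ad _)); case: subG => _; apply.
have Lad b' : lcs m.+1 (ad b' e) by apply: lcs_ad.
pose f u v w := ad (u * v * w) (ad b e).
pose h u v w := - (ad (u * v) (ad (w * b) e) *+ 3) + ad u (ad (v * w * b) e)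
  *+ 3.
have Gfh : genspan (sum6 (fun u v w => f u v w + h u v w) p q r).
  apply: lcs_genspan; have := ad_sym3_lcs p q r b charF0 m_gt0 Le.
  by rewrite /sum6 /f /h !addrA.
have Gh : genspan (sum6 h p q r).
  rewrite /sum6 /h; do ?[apply: (subspaceN subG)|apply: (subspaceD subG)];
    by [apply: Rp|apply: Rq|apply: Rr|apply: Rpq|apply: Rpr|apply: Rqr
         |apply: Rqp|apply: Rrp|apply: Rrq].
rewrite [X in genspan X](_ : _ = sum6 f p q r); last by rewrite /T /sum6 !adDl.
by rewrite -[sum6 f _ _ _](addrK (sum6 h p q r)) -sum6D;
  apply: (subspaceB subG).
Qed.

(** Modulo commutators the six products fall into two classes of rotations, so [sum6] is 3 (p q r +
    p r q). *)
Lemma reaches_swap p q r : reaches p -> reaches q -> reaches r ->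
    reaches (p * q) -> reaches (p * r) -> reaches (q * r) ->
  reaches (p * q * r + p * r * q).
Proof.
move=> Rp Rq Rr Rpq Rpr Rqr; apply: (@subspaceMnK _ _ _ subR _ 2 charF0).
apply: (subspaceKB subR _ (reaches_sum6 Rp Rq Rr Rpq Rpr Rqr)).
rewrite [X in reaches X](_ : _ = ad (q * r) p + ad r (p * q) + ad q (p * r) +
  ad (r * q) p).
  by do ?apply: (subspaceD subR); apply: reaches_ad.
by rewrite /sum6 !adE; ncring [:: p; q; r].
Qed.

Lemma reaches_rot s t : reaches (xword (s ++ t)) -> reaches (xword (t ++ s)).
Proof. by rewrite !xword_cat; apply: reaches_mulC. Qed.

Lemma reaches_nil : reaches (xword [::]).
Proof.
move=> l Ll; rewrite /xword big_nil adE mul1r mulr1 subrr.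
exact: subspace0 subG.
Qed.

Section Words.
(** Taken to be [uniq] for words with distinct letters, then [predT] for all words once squares are
    known to be good. *)
Variable P : pred (seq I).
Hypothesis P_perm : forall s t, perm_eq s t -> P s -> P t.
Hypothesis P_prefix : forall s t, P (s ++ t) -> P s.

(** As the blocks are nonempty, each block and each product of two is strictly shorter than the
    whole, hence good by [IH]; it satisfies P as a prefix of a rearrangement. *)
Lemma reaches_swap_word d (u v w : seq I) :
    (0 < size u)%N -> (0 < size v)%N -> (0 < size w)%N ->
    (size (u ++ v ++ w) <= d.+1)%N -> P (u ++ v ++ w) ->
    (forall s, P s -> (size s <= d)%N -> reaches (xword s)) ->
  reaches (xword (u ++ v ++ w) + xword (u ++ w ++ v)).
Proof.
move=> u0 v0 w0 sz Puvw IH.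
have [le_u le_v le_w] :
    [/\ (size u <= d)%N, (size v <= d)%N & (size w <= d)%N].
  by rewrite !size_cat in sz; split; lia.
have [le_uv le_uw le_vw] : [/\ (size (u ++ v) <= d)%N,
    (size (u ++ w) <= d)%N & (size (v ++ w) <= d)%N].
  by rewrite !size_cat in sz *; split; lia.
have Pvuw : P (v ++ u ++ w) by apply: P_perm Puvw; rewrite perm_catCA.
have Puwv : P (u ++ w ++ v) by apply: P_perm Puvw; rewrite perm_cat2l perm_catC.
have Pvwu : P ((v ++ w) ++ u) by apply: P_perm Puvw; rewrite perm_catC.
have Pwuv : P (w ++ u ++ v) by apply: P_perm Puvw; rewrite catA perm_catC.
rewrite !xword_cat !mulrA; apply: reaches_swap; rewrite -?xword_cat;
  apply: IH => //.
- exact: P_prefix Puvw.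
- exact: P_prefix Pvuw.
- exact: P_prefix Pwuv.
- by apply: (@P_prefix _ w); rewrite -catA.
- by apply: (@P_prefix _ v); rewrite -catA.
- exact: P_prefix Pvwu.
Qed.

(** Induction on length. In length 3 a repeated letter can be rotated to the last two places; from
    length 4 on, two computations of the sign of one exchange disagree. *)
Lemma reaches_words :
    (forall s, P s -> (size s <= 2)%N -> reaches (xword s)) ->
    (forall s, P s -> uniq s -> size s = 3 -> reaches (xword s)) ->
  forall s, P s -> reaches (xword s).
Proof.
move=> P2 P3 s; have [d] := ubnP (size s); elim: d s => // d IH s.
rewrite ltnS => sz Ps.
have {}IH t : P t -> (size t < size s)%N -> reaches (xword t).
  by move=> Pt lt_ts; apply: IH => //; apply: leq_trans sz.
case: (leqP (size s) 2) => [|s_gt2]; first exact: P2.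
have swap (u v w : seq I) :
    (0 < size u)%N -> (0 < size v)%N -> (0 < size w)%N ->
    perm_eq s (u ++ v ++ w) -> reaches (xword (u ++ v ++ w) + xword (u ++ w ++
      v)).
  move=> u0 v0 w0 eq_s; apply: (@reaches_swap_word (size s).-1) => //.
  - by rewrite -(perm_size eq_s) (ltn_predK s_gt2).
  - exact: P_perm Ps.
  - by move=> t Pt le_ts; apply: IH => //; rewrite -(ltn_predK s_gt2) ltnS.
have [p [i [j [k def_s]]]] : exists (p : seq I) i j k, s = p ++ [:: i; j; k].
  exists (take (size s - 3) s); rewrite -{1}(cat_take_drop (size s - 3) s).
  have: size (drop (size s - 3) s) = 3 by rewrite size_drop subKn.
  by case: (drop _ s) => [|i [|j [|k []]]] //= _; exists i, j, k.
case: (posnP (size p)) => [/size0nil p0|p0].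
  (* Exchanging two equal letters both fixes the word and changes its sign, so twice the word is
     good. *)
  have dup (u v w : I) : perm_eq s [:: u; v;
    w] -> v = w -> reaches (xword [:: u; v; w]).
    move=> eq_s eq_vw; apply: (@subspaceMnK _ _ _ subR _ 1 charF0).
    rewrite {v}eq_vw in eq_s *.
    by rewrite mulr2n; apply: (swap [:: u] [:: w] [:: w]).
  rewrite def_s p0 /= in dup P3 *.
  have [eq_jk|ne_jk] := eqVneq j k; first exact: dup.
  have [eq_ij|ne_ij] := eqVneq i j.
    apply: (@reaches_rot [:: k] [:: i; j]); apply: dup => //.
    exact: (permEl (perm_catC [:: i; j] [:: k])).
  have [eq_ki|ne_ki] := eqVneq k i.
    apply: (@reaches_rot [:: j; k] [:: i]); apply: dup => //.
    exact: (permEl (perm_catC [:: i] [:: j; k])).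
  apply: P3 => //; first by move: Ps; rewrite def_s p0.
  by rewrite /= !inE negb_or ne_ij ne_jk eq_sym ne_ki.
have pijk : perm_eq s (p ++ [:: i; j] ++ [:: k]) by rewrite def_s.
have pkij : perm_eq s (p ++ [:: k] ++ [:: i; j]).
  by apply: perm_trans pijk _; rewrite perm_cat2l perm_catC.
have jpki : perm_eq s (([:: j] ++ p) ++ [:: k] ++ [:: i]).
  by apply: perm_trans pkij _; rewrite -catA perm_sym (perm_catC [:: j]) -!catA.
have pikj : perm_eq s ((p ++ [:: i]) ++ [:: k] ++ [:: j]).
  by apply: perm_trans pijk _; rewrite -catA perm_cat2l /= perm_cons
    (perm_catC [:: j] [:: k]).
(* Moving k before the block i j is one exchange of blocks, possible because p is nonempty, but also
   two exchanges of letters, [R3] then [R2]. *)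
have R1 := swap p [:: i; j] [:: k] p0 isT isT pijk.
have R2 : reaches (xword (p ++ [:: k; i; j]) + xword (p ++ [:: i; k; j])).
  (* The final j is rotated to the front, so that k and i become the last two blocks. *)
  have : reaches (xword [:: j] * (xword (p ++ [:: k; i]) + xword (p ++ [:: i;
    k]))).
    by rewrite mulrDr -!xword_cat; exact: (swap ([:: j] ++ p) [:: k] [:: i]).
  by move/reaches_mulC; rewrite mulrDl -!xword_cat -!catA.
have R3 : reaches (xword (p ++ [:: i; k; j]) + xword (p ++ [:: i; j; k])).
  have pi0 : (0 < size (p ++ [:: i]))%N by rewrite size_cat addn1.
  by have := swap (p ++ [:: i]) [:: k] [:: j] pi0 isT isT pikj; rewrite -!catA.
rewrite def_s; apply: (@subspaceMnK _ _ _ subR _ 1 charF0).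
rewrite /= in R1; set x := xword (p ++ [:: i; j; k]) in R1 R3 *.
set y := xword (p ++ [:: k; i; j]) in R1 R2.
set z := xword (p ++ [:: i; k; j]) in R2 R3.
have -> : x *+ 2 = x + y - (y + z) + (z + x) by ncring [:: x; y; z].
by apply: (subspaceD subR) => //; apply: (subspaceB subR).
Qed.

End Words.

Lemma uniq_perm_closed s t : perm_eq s t -> uniq s -> uniq t.
Proof. by move/perm_uniq->. Qed.

Lemma uniq_prefix s t : uniq (s ++ t) -> uniq s.
Proof. by rewrite cat_uniq => /andP[]. Qed.

(** After a rotation s starts with the first letter of t; the at most two letters left agree or
    differ by one exchange. *)
Lemma reaches_perm s t : uniq s -> (size s <= 3)%N ->
    (forall u, uniq u -> (size u < size s)%N -> reaches (xword u)) ->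
  perm_eq s t -> reaches (xword s) -> reaches (xword t).
Proof.
case: t => [|i t] Us s_le3 IH eq_st Rs.
  by move: eq_st => /perm_small_eq <-.
have /rot_to[d u def_u] : i \in s by rewrite (perm_mem eq_st) mem_head.
have Riu : reaches (xword (i :: u)).
  by rewrite -def_u; apply: reaches_rot; rewrite cat_take_drop.
have Uiu : uniq (i :: u) by rewrite -def_u rot_uniq.
have s_iu : size s = (size u).+1 by rewrite -(size_rot d) def_u.
have: perm_eq t u by rewrite perm_sym -(perm_cons i) -def_u perm_rot.
case: u {def_u} Riu Uiu s_iu => [|a [|b [|c u]]] Riu Uiu s_iu.
- by move=> /perm_small_eq ->.
- by move=> /perm_small_eq ->.
- move/perm_pair=> [] -> //; rewrite s_iu in IH.
  have := @reaches_swap_word uniq uniq_perm_closed uniq_prefix 2 [:: i] [:: a]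
    [:: b]
    isT isT isT isT Uiu (fun v Uv => IH v Uv).
  by move/(subspaceB subR)/(_ Riu); rewrite addrC addKr.
by rewrite s_iu in s_le3.
Qed.

(** Up to length 3 such a word is a permutation of some [xword (enum S)], which is good by the
    choice of W; [reaches_words] does the rest. *)
Lemma reaches_uniq s : uniq s -> reaches (xword s).
Proof.
have R3 t : uniq t -> (size t <= 3)%N -> reaches (xword t).
  have [d] := ubnP (size t); elim: d t => // d IH t lt_td Ut t_le3.
  have [/size0nil->|t_gt0] := posnP (size t); first exact: reaches_nil.
  have sh_t : short [set x in t].
    by rewrite /short cardsE (card_uniqP _) // t_gt0.
  apply: (@reaches_perm (enum [set x in t])); rewrite ?enum_uniq -?cardE //.
  - by case/andP: sh_t.
  - rewrite cardsE (card_uniqP _) // => u Uu lt_ut; apply: IH => //.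
      exact: leq_trans lt_ut _.
    exact: leq_trans (ltnW lt_ut) _.
  - by apply: uniq_perm; rewrite ?enum_uniq // => x; rewrite mem_enum inE.
  by move=> l Ll; apply: genspan_ad.
apply: reaches_words; [exact: uniq_perm_closed|exact: uniq_prefix| |].
  by move=> t Ut t_le2; apply: R3 => //; apply: leq_trans t_le2 _.
by move=> t _ Ut t3; apply: R3; rewrite ?t3.
Qed.

(** L_(m+1) is L_(m+2) plus the sum of the [u, L_m], as an induction principle. Known at level m, it
    reduces the squares at level m + 1 to brackets [u, g]. *)
Definition generated := forall (T : A -> Prop) l, subspace T ->
  (forall S g, short S -> lcs m g -> T (ad (xword (enum S)) g)) ->
  (forall x, lcs m.+2 x -> T x) -> lcs m.+1 l -> T l.

(** The Jacobi identity twice, since [a^2, u] = [a, a u + u a]. *)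
Lemma ad_square a u g : ad (a * a) (ad u g) =
  ad u (ad (a * a) g) + ad a (ad (a * u + u * a) g)
    - ad (a * u + u * a) (ad a g).
Proof. by rewrite !adE; ncring [:: a; u; g]. Qed.

(* Let c be the sum of the three rotations of a ^ 2 w. Modulo the span,
   [a ^ 2, [a w, g]] is -2/3 [c, [a, g]] by ad_square and 1/3 [c, [a, g]] by
   ad_sym3_lcs, hence 0. *)
Lemma reaches_square_mul a w g : reaches a -> reaches w -> reaches (a * w) ->
  lcs m g -> genspan (ad (a * a) (ad (a * w) g)).
Proof.
move=> Ra Rw Raw Lg.
have Rwa : reaches (w * a) by apply: reaches_mulC.
have Lad b : lcs m.+1 (ad b g) by apply: lcs_ad.
(* Here [c] holds only two of the three rotations, so modulo the span [D] is - [d], while [D'] is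
   half of [d]. *)
pose c := a * (a * w) + a * w * a; pose d := ad c (ad a g).
pose D := ad (a * a) (ad (a * w) g); pose D' := ad (a * a) (ad (w * a) g).
have G1 : genspan (D + d).
  rewrite /D ad_square -/c -/d subrK.
  by apply: (subspaceD subG); [apply: Raw|apply: Ra]; apply: lcs_ad.
have G2 : genspan (D - D').
  apply: lcs_genspan; rewrite -(raddfB (ad _)) -adBl -adE.
  by apply: lcs_ad => //; apply: lcs2_ad => //; apply: lcs_ad.
have G3 : genspan (d *+ 3 - D' *+ 6).
  (* The polarized identity at (a, a, w) with b = a and e = g; each distinct term occurs twice. *)
  have := ad_sym3_lcs a a w a charF0 m_gt0 Lg; rewrite /sum6 => /lcs_genspan.
  set y := ad a g; set t1 := ad (a * a * w) y; set t2 := ad (a * w * a) y.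
  set t3 := ad (w * a * a) y; rewrite -/D'.
  set p2 := ad (a * w) _; set p3 := ad (w * a) _;
    set q1 := ad a (ad (a * w * a) g).
  set q2 := ad a (ad (w * a * a) g); set q3 := ad w _ => GS.
  have Gt : genspan (t3 - t1 + (t3 - t2)).
    have -> : t3 - t1 = ad (ad w (a * a)) y by rewrite -adBl [ad w _]adE mulrA.
    have -> : t3 - t2 = ad (ad (w * a) a) y by rewrite -adBl [ad (w * a) a]adE
      mulrA.
    by apply: (subspaceD subG); apply: reaches_ad; apply: lcs_ad.
  have Gp : genspan (p2 + p3).
    by apply: (subspaceD subG); [apply: Raw|apply: Rwa]; apply: lcs_ad.
  have Gq : genspan (q1 + q2 + q3).
    by do ?apply: (subspaceD subG); by [apply: Ra; apply: lcs_ad|apply: Rw;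
      apply: lcs_ad].
  have dE : d = t1 + t2 by rewrite /d /c adDl mulrA.
  move: (subspaceB subG (subspaceD subG GS (subspaceMn subG 6 Gp))
    (subspaceD subG Gt (subspaceMn subG 6 Gq))).
  congr genspan; rewrite dE; ncring [:: t1; t2; t3; D'; p2; p3; q1; q2; q3].
apply: (@subspaceMnK _ _ _ subG _ 8 charF0).
have -> : ad (a * a) (ad (a * w) g) *+ 9 = (D + d) *+ 3 - (d *+ 3 - D' *+ 6) +
  (D - D') *+ 6.
  by rewrite -/D; ncring [:: D; D'; d].
by apply: (subspaceD subG); [apply: (subspaceB subG)|];
  do ?apply: (subspaceMn subG).
Qed.

(** By [generated] it suffices to treat l = [u, g]. If X i occurs in u, rotate it to the front and
    use [reaches_square_mul]; otherwise X i times u has distinct letters, and every term of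
    [ad_square] starts with a good element. *)
Lemma reaches_square i : generated -> reaches (X i * X i).
Proof.
move=> gen l Ll; have Rxi : reaches (X i) by rewrite -xword1;
  apply: reaches_uniq.
apply: (gen (fun l => genspan (ad (X i * X i) l)) l _ _ _ Ll).
- split=> [|c x y Gx Gy]; first by rewrite (raddf0 (ad _));
  apply: subspace0 subG.
  by rewrite (linearP (ad _)); case: subG => _; apply.
- move=> S g _ Lg; have [iS|iNS] := boolP (i \in S).
    have /rot_to[d w def_w] : i \in enum S by rewrite mem_enum.
    have Uiw : uniq (i :: w) by rewrite -def_w rot_uniq enum_uniq.
    have /andP[_ Uw] := Uiw.
    rewrite -(subrK (xword (i :: w)) (xword (enum S))) adDl (raddfD (ad _)).
    apply: (subspaceD subG).
      apply: lcs_genspan; apply: lcs_ad => //; apply: lcs2_ad => //.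
      by rewrite -def_w -{1}(cat_take_drop d (enum S)); apply: lcs2_rot.
    rewrite /xword big_cons; apply: reaches_square_mul => //.
      exact: reaches_uniq.
    by have := reaches_uniq Uiw; rewrite /xword big_cons.
  have Uie : uniq (i :: enum S) by rewrite /= mem_enum iNS enum_uniq.
  have Rie := reaches_uniq Uie; rewrite /xword big_cons in Rie.
  rewrite ad_square; apply: (subspaceB subG); first apply: (subspaceD subG).
  + by apply: reaches_uniq; [exact: enum_uniq|apply: lcs_ad].
  + by apply: Rxi; apply: lcs_ad.
  by apply: (subspaceD subR Rie (reaches_mulC Rie)); apply: lcs_ad.
- by move=> x Lx; apply: lcs_genspan; apply: lcs_ad.
Qed.

Lemma reaches_all a : generated -> reaches a.
Proof.
move=> gen; apply: xword_span => // w.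
apply: (@reaches_words predT) => // [s _|s _ Us _]; last exact: reaches_uniq.
case: s => [|i [|j []]] // _; [exact: reaches_nil|exact: reaches_uniq|].
have [->|ne_ij] := eqVneq i j; last by apply: reaches_uniq;
  rewrite /= inE ne_ij.
by rewrite /xword big_cons big_seq1; apply: reaches_square.
Qed.

End Level.
(** Start of the induction: L_2 is the sum of the [X i, A], and singletons are short. *)
Lemma generated1 : generated 1.
Proof.
move=> T l subT T_ad _ /(lcs2E xword_span)[b ->].
apply: (subspace_sum subT) => i _; rewrite -(xword1 X) -enum_set1.
by apply: T_ad; rewrite ?/short ?cards1.
Qed.

(** Generation at level m makes every element good for L_(m+1), and this gives generation at level m
    + 1. *)
Lemma generated_all m : (0 < m)%N -> generated m.
Proof.
elim: m => // [[_ _|m IH _]]; first exact: generated1.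
move=> T l subT T_ad T_lcs; apply: (@lcs_min _ _ m.+2) => // a b Lb.
have [g [Lg Lx]] := @reaches_all m.+1 isT a (IH isT) b Lb.
apply: (subspaceBK subT (T_lcs _ Lx)).
by apply: (subspace_sum subT) => S shS; apply: T_ad.
Qed.

Theorem lcs_genspan_all m x : (1 < m)%N -> lcs m.+1 x -> genspan m x.
Proof.
case: m => [|[|m]] // _; apply: lcs_min => //; first exact: genspan_subspace.
move=> a b; apply: reaches_all => //; exact: generated_all.
Qed.

End Generation.

(** * Dimensions and Hilbert polynomials *)

(** If k exceeded the size of J, the coefficient matrix would have a nonzero left kernel, a relation
    modulo Q among the v i. *)
Lemma dim_mod_le (F : fieldType) (V : lmodType F) (P Q : V -> Prop) k
    (J : finType) (w : J -> V) :
    subspace Q -> dim_mod P Q k ->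
    (forall x, P x -> exists c : J -> F, Q (x - \sum_j c j *: w j)) ->
  (k <= #|J|)%N.
Proof.
move=> subQ [v [Pv v_free _]] w_gen; rewrite leqNgt; apply/negP => lt_Jk.
have [C QC] := fin_all_exists (fun i => w_gen _ (Pv i)).
pose M := \matrix_(i < k, j < #|J|) C i (enum_val j).
have: kermx M != 0.
  rewrite kermx_eq0 /row_free; apply/eqP => rankM.
  by have := rank_leq_col M; rewrite rankM leqNgt lt_Jk.
case/rowV0Pn => u /sub_kermxP uM u_neq0; case/negP: u_neq0; apply/eqP/rowP => i.
rewrite mxE; apply: (v_free (fun i => u 0 i)).
have uC0 : \sum_i u 0 i *: (\sum_j C i j *: w j) = 0.
  under eq_bigr do rewrite scaler_sumr; rewrite exchange_big big1 //= => j _.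
  under eq_bigr do rewrite scalerA; rewrite -scaler_suml.
  have /rowP/(_ (enum_rank j)) := uM; rewrite !mxE.
  by under eq_bigr do rewrite mxE enum_rankK; move->; rewrite scale0r.
rewrite -[X in Q X]subr0 -[X in _ - X]uC0 -sumrB.
under eq_bigr do rewrite -scalerBr.
by apply: (subspace_sum subQ) => i' _; apply: (subspaceZ subQ).
Qed.

(** Dividing by a negative leading coefficient gives a monic polynomial, positive far out, so p
    would be negative there. *)
Lemma lead_coef_ge0 (R : archiRealFieldType) (p : {poly R}) N :
  (forall d, (N <= d)%N -> 0 <= p.[d%:R]) -> 0 <= lead_coef p.
Proof.
move=> p_ge0; rewrite leNgt; apply/negP => lp_lt0.
have lp_neq0 : lead_coef p != 0 by rewrite lt_eqF.
have [b q_gt0] : {b | forall x, x >= b -> ((lead_coef p)^-1 *: p).[x] > 0}.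
  by apply: monic_Cauchy_bound; rewrite monicE lead_coefZ mulVf.
pose d := maxn N (Num.bound `|b|); have := p_ge0 d (leq_maxl _ _).
rewrite leNgt => /negP[]; have : b <= d%:R.
  apply: le_trans (ler_norm b) _; apply: le_trans (ltW (archi_boundP
    (normr_ge0 b))) _.
  by rewrite ler_nat leq_maxr.
by move/q_gt0; rewrite hornerZ nmulr_rgt0 ?invr_lt0.
Qed.

(** Shifting the variable preserves the leading coefficient; compare coefficients of degree n in the
    difference [r]. *)
Lemma lead_coef_shift_le (R : archiRealFieldType) n (p q : {poly R}) N
    (J : finType) (P : pred J) (h : J -> nat) (B : nat) :
    size p = n.+1 -> size q = n.+1 -> (forall j, P j -> h j <= B)%N ->
    (forall d, (N <= d)%N -> q.[d%:R] <= \sum_(j | P j) p.[(d - h j)%:R]) ->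
  lead_coef q <= lead_coef p *+ #|P|.
Proof.
move=> sp sq hB qp.
pose r := \sum_(j | P j) (p \Po ('X - (h j)%:R%:P)) - q.
have size_comp j : size (p \Po ('X - (h j)%:R%:P)) = n.+1.
  by rewrite size_comp_poly2 // size_XsubC.
have size_r : (size r <= n.+1)%N.
  apply: leq_trans (size_polyD _ _) _;
    rewrite geq_max size_polyN sq leqnn andbT.
  by apply: leq_trans (size_sum _ _ _) _; apply/bigmax_leqP => j _;
    rewrite size_comp.
have coef_r : r`_n = lead_coef p *+ #|P| - lead_coef q.
  rewrite coefB coef_sum; congr (_ - _); last by rewrite /lead_coef sq.
  rewrite -sumr_const; apply: eq_bigr => j _.
  transitivity (lead_coef (p \Po ('X - (h j)%:R%:P)));
    first by rewrite /lead_coef size_comp.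
  by rewrite lead_coef_comp ?size_XsubC // lead_coefXsubC expr1n mulr1.
(* From B on, the truncated [d - h j] is the true difference. *)
have r_ge0 d : (maxn N B <= d)%N -> 0 <= r.[d%:R].
  rewrite geq_max => /andP[Nd Bd]; rewrite hornerD hornerN subr_ge0 horner_sum.
  apply: le_trans (qp d Nd) _; apply: ler_sum => j Pj.
  by rewrite horner_comp hornerXsubC -natrB // (leq_trans (hB j Pj)).
rewrite -subr_ge0 -coef_r; have [lt_rn|le_nr] := ltnP (size r) n.+1.
  by rewrite nth_default.
have sr : size r = n.+1 by apply/eqP; rewrite eqn_leq size_r.
by have := lead_coef_ge0 r_ge0; rewrite /lead_coef sr.
Qed.

(** * Graded components and the bound on dimensions *)

Section Graded.
Variables (F : fieldType) (A : algType F) (I : finType) (X : I -> A).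
Hypothesis charF0 : [pchar F] =i pred0.
Hypothesis xword_span : forall (S : A -> Prop) a,
  subspace S -> (forall s, S (xword X s)) -> S a.
Local Notation lcs := (@alg_lcs F A).
Local Notation xword := (xword X).
Implicit Types (a b g x : A) (s : seq I) (S : {set I}).

Variable comp : nat -> {linear A -> A}.
Hypothesis comp_xword : forall d s,
  comp d (xword s) = if size s == d then xword s else 0.

Lemma comp_idem d a : comp d (comp d a) = comp d a.
Proof.
apply: (@xword_span (fun a => comp d (comp d a) = comp d a)) => [|s].
  by split=> [|c x y IHx IHy]; rewrite ?raddf0 // !linearP IHx IHy.
by rewrite comp_xword; case: ifP => sz; rewrite ?raddf0 // comp_xword sz.
Qed.

Lemma compM d a b : comp d (a * b) = \sum_(i < d.+1) comp i a * comp (d - i) b.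
Proof.
apply: (@xword_span (fun a => comp d (a * b) =
    \sum_(i < d.+1) comp i a * comp (d - i) b)) => [|s].
  split=> [|c x y IHx IHy].
    by rewrite mul0r raddf0 big1 // => i _; rewrite raddf0 mul0r.
  rewrite mulrDl -scalerAl linearP IHx IHy scaler_sumr -big_split.
  by apply: eq_bigr => i _; rewrite linearP mulrDl -scalerAl.
apply: (@xword_span (fun b => comp d (xword s * b) =
    \sum_(i < d.+1) comp i (xword s) * comp (d - i) b)) => [|t].
  split=> [|c x y IHx IHy].
    by rewrite mulr0 raddf0 big1 // => i _; rewrite raddf0 mulr0.
  rewrite mulrDr -scalerAr linearP IHx IHy scaler_sumr -big_split.
  by apply: eq_bigr => i _; rewrite linearP mulrDr -scalerAr.
rewrite -xword_cat comp_xword size_cat.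
have [lt_sd|le_ds] := ltnP (size s) d.+1; last first.
  rewrite ifN; last by rewrite neq_ltn (leq_trans le_ds) ?leq_addr ?orbT.
  rewrite big1 // => i _; rewrite comp_xword ifN ?mul0r //.
  by rewrite neq_ltn (leq_trans (ltn_ord i)) ?orbT.
rewrite (bigD1 (Ordinal lt_sd)) //= !comp_xword eqxx big1 ?addr0 => [|i ne_i].
  have le_sd : (size s <= d)%N by [].
  rewrite -{1}(subnKC le_sd) eqn_add2l.
  by case: ifP; rewrite ?mulr0 // xword_cat.
rewrite comp_xword ifN ?mul0r //.
by apply: contraNneq ne_i => eq_i; apply/eqP/val_inj.
Qed.

Lemma comp_ad d a b : comp d (ad a b) = \sum_(i < d.+1) ad (comp i a) (comp (d
  - i) b).
Proof.
under [RHS]eq_bigr do rewrite adE; rewrite adE raddfB /= !compM sumrB;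
  congr (_ - _).
rewrite (reindex_inj rev_ord_inj); apply: eq_bigr => i _ /=.
by rewrite subSS subKn // -ltnS.
Qed.

(** L_m is a graded subspace: a component of [a, b] is a sum of brackets of components. *)
Lemma comp_lcs d m x : lcs m x -> lcs m (comp d x).
Proof.
elim: m d x => [|[|m] IH] // d x.
apply: (@lcs_min _ _ m.+1 (fun x => lcs m.+2 (comp d x))) => // [|a b Lb].
  split=> [|c y z Ly Lz]; first by rewrite raddf0;
    apply: subspace0 (lcs_subspace _ _).
  by rewrite linearP; case: (lcs_subspace A m.+2) => _; apply.
rewrite comp_ad; apply: (subspace_sum (lcs_subspace _ _)) => i _.
by apply: lcs_ad => //; apply: IH.
Qed.

Lemma comp_ad_xword d s g : (size s <= d)%N ->
  comp d (ad (xword s) g) = ad (xword s) (comp (d - size s) g).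
Proof.
rewrite -ltnS => lt_sd; rewrite comp_ad (bigD1 (Ordinal lt_sd)) //=.
rewrite comp_xword eqxx big1 ?addr0 // => i ne_i.
rewrite comp_xword ifN ?adE ?mul0r ?mulr0 ?subrr //.
by apply: contraNneq ne_i => eq_i; apply/eqP/val_inj.
Qed.

Definition comp_lcs_pred m d a := lcs m a /\ comp d a = a.

(** Write x as a sum of [u, g S] modulo L_(m+2) and take degree d. The component of g S of degree d
    - deg u is expanded in a basis modulo L_(m+1), and the error stays in L_(m+2) after bracketing
    with u. *)
Lemma dim_lcs_le m d k (h : {set I} -> nat) : (1 < m)%N -> (2 < d)%N ->
    dim_mod (comp_lcs_pred m.+1 d) (lcs m.+2) k ->
    (forall S, short S -> dim_mod (comp_lcs_pred m (d - #|S|)) (lcs m.+1) (h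
      S)) ->
  (k <= \sum_(S | short S) h S)%N.
Proof.
move=> m_gt1 d_gt2 dim_k dim_h; have m_gt0 := ltnW m_gt1.
(* The value 0 off short sets makes those fibres empty, so the spanning family is indexed by a plain
   sigma type. *)
pose h' S := if short S then h S else 0%N.
have /fin_all_exists[v vP] S : exists v : 'I_(h' S) -> A, forall g, short S ->
    comp_lcs_pred m (d - #|S|) g ->
    exists c : 'I_(h' S) -> F, lcs m.+1 (g - \sum_i c i *: v i).
  rewrite /h'; case: ifP => [shS|_]; last by exists (fun=> 0).
  by have [v [_ _ v_gen]] := dim_h S shS; exists v => g _ /v_gen.
pose w (j : {S : {set I} & 'I_(h' S)}) :=
  ad (xword (enum (tag j))) (v _ (tagged j)).
suff w_gen x : comp_lcs_pred m.+1 d x -> exists c : _ -> F,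
    lcs m.+2 (x - \sum_j c j *: w j).
  have := dim_mod_le (lcs_subspace A m.+2) dim_k w_gen.
  rewrite card_tagged sumnE big_map big_enum [X in _ ->
    (_ <= X)%N]big_mkcond /=.
  by under eq_bigr do rewrite card_ord.
move=> [Lx comp_x].
have [g [Lg Lxg]] := lcs_genspan_all charF0 xword_span m_gt1 Lx.
have /fin_all_exists[c cP] S : exists c : 'I_(h' S) -> F, short S ->
    lcs m.+1 (comp (d - #|S|) (g S) - \sum_i c i *: v S i).
  case: (boolP (short S)) => [shS|_]; last by exists (fun=> 0).
  have [|c Lc] := vP S (comp (d - #|S|) (g S)) shS; last by exists c.
  split; first exact: comp_lcs.
  exact: comp_idem.
exists (fun j => c (tag j) (tagged j)).
have -> : \sum_j c (tag j) (tagged j) *: w j =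
    \sum_(S | short S) ad (xword (enum S)) (\sum_i c S i *: v S i).
  rewrite [RHS]big_mkcond.
  rewrite -(sig_big_dep xpredT (fun=> xpredT)
    (fun S (i : 'I_(h' S)) => c S i *: ad (xword (enum S)) (v S i))) /=.
  apply: eq_bigr => S _; case: (boolP (short S)) => [shS|/negPf nshS].
    by rewrite linear_sum; apply: eq_bigr => i _; rewrite linearZ.
  rewrite big1 // => i; have: (i < 0)%N by have := ltn_ord i;
    rewrite {2}/h' nshS.
  by [].
have Lrest : lcs m.+2 (\sum_(S | short S) (comp d (ad (xword (enum S)) (g S))
    - ad (xword (enum S)) (\sum_i c S i *: v S i))).
  apply: (subspace_sum (lcs_subspace _ _)) => S shS.
  have sz : size (enum S) = #|S| by rewrite cardE.
  rewrite comp_ad_xword sz; last by case/andP: shS => _ /leq_trans->.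
  by rewrite -(raddfB (ad _)); apply: lcs_ad => //; apply: cP.
have := comp_lcs d Lxg; rewrite raddfB /= comp_x linear_sum /=.
move/(subspaceD (lcs_subspace _ _))/(_ Lrest).
by rewrite sumrB addrA subrK.
Qed.

End Graded.

(** * The free algebra *)

Section FreeAlgebra.
Variables (F : fieldType) (n : nat).
Local Notation A := {malg F[{fmonom 'I_n}]}.
Implicit Types s t : seq 'I_n.

Fact malg_scalerAr (c : F) (a b : A) : c *: (a * b) = a * (c *: b).
Proof.
have malgC_comm : malgC c * a = a * malgC c.
  rewrite !malgM_def fgmulUg fgmulgU; apply: eq_bigr => k _.
  by rewrite mul1m mulm1 mulrC.
rewrite -[LHS]mul_malgC mulrA malgC_comm -mulrA mul_malgC; reflexivity.
Qed.

Lemma malgUZ (c : F) (k : {fmonom 'I_n}) : << c *g k >> = c *: << k >> :> A.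
Proof.
apply/malgP => l; rewrite mcoeffZ [LHS]mcoeffU [X in c * X]mcoeffU mulr_natr.
reflexivity.
Qed.

(* An alias, because the canonical algebra structure of {malg F[K]} in monalg
   requires the monoid K to be commutative. *)
Definition freealg : predArgType := A.
HB.instance Definition _ := GRing.Lalgebra.copy freealg A.
HB.instance Definition _ := GRing.Lalgebra_isAlgebra.Build F freealg
  malg_scalerAr.



Implicit Types (a b : freealg).

Definition letter i : freealg := << fmu i >>.

Local Notation xword := (@xword F freealg 'I_n letter).

Lemma xword_letter s : xword s = << FMonom s >>.
Proof.
elim: s => [|i s IH]; first by rewrite /xword big_nil -fmoneE.
rewrite -cat1s xword_cat xword1 IH /letter malgM_def fgmulUU mulr1.
by congr mkmalgU; apply/eqP; rewrite fmP fmM fmU.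
Qed.

Lemma xword_letter_span (S : freealg -> Prop) a :
  subspace S -> (forall s, S (xword s)) -> S a.
Proof.
move=> subS Sx; rewrite [a]monalgE; apply: (subspace_sum subS) => -[s] _.
rewrite malgUZ -xword_letter; exact: (subspaceZ subS).
Qed.

Lemma lcsE m a : @lcs F n m a <-> @alg_lcs F freealg m a.
Proof.
elim: m a => [|[|m] IH] // a.
split; apply: linear_span_min; do ?exact: linear_span_subspace.
  move=> _ [b [c [_ Lc ->]]]; apply: linear_span_incl; exists b, c.
  by rewrite adE; split=> //; apply/IH.
move=> _ [b [c [Lc ->]]]; apply: linear_span_incl; exists b, c.
by rewrite adE; split=> //; apply/IH.
Qed.

Definition component d a : freealg :=
  [malg k in msupp a => if fdeg k == d then a@_k else 0].

Lemma mcoeff_component d a k :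
  (component d a)@_k = if fdeg k == d then a@_k else 0.
Proof.
rewrite mcoeffE; case: ifPn => // k_out.
by rewrite mcoeff_outdom // if_same.
Qed.

Fact component_is_linear d : linear (component d).
Proof.
move=> c a b; apply/malgP => k; rewrite mcoeffD mcoeffZ !mcoeff_component.
by rewrite mcoeffD mcoeffZ; case: ifP => // _; rewrite mulr0 addr0.
Qed.

HB.instance Definition _ d :=
  GRing.isLinear.Build F freealg freealg *:%R (component d)
    (component_is_linear d).

Lemma homogeneousE d a : homogeneous d a <-> component d a = a.
Proof.
split=> [hom_a|<- k].
  apply/malgP => k; rewrite mcoeff_component; case: eqP => // ne_kd.
  by have [//|/hom_a] := eqVneq a@_k 0.
by rewrite mcoeff_component; case: (eqVneq (fdeg k) d) => // _ /eqP[].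
Qed.

Lemma component_xword d s :
  component d (xword s) = if size s == d then xword s else 0.
Proof.
apply/malgP => k; rewrite mcoeff_component xword_letter.
case: (eqVneq (FMonom s) k) => [<-|ne_sk].
  by rewrite fdegE; case: (size s == d); rewrite // mcoeff0.
rewrite [<< _ >>@_k]mcoeffU (negPf ne_sk) if_same.
by case: ifP => _; rewrite ?mcoeff0 // mcoeffU (negPf ne_sk).
Qed.

Lemma dim_B_le m d k (h : {set 'I_n} -> nat) : [pchar F] =i pred0 ->
    (1 < m)%N -> (2 < d)%N -> dim_B F n m.+1 d k ->
    (forall S, short S -> dim_B F n m (d - #|S|) (h S)) ->
  (k <= \sum_(S : {set 'I_n} | short S) h S)%N.
Proof.
move=> charF0 m_gt1 d_gt2.
have dimE m' d' k' : dim_B F n m' d' k' ->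
    dim_mod (comp_lcs_pred component m' d') (@alg_lcs F freealg m'.+1) k'.
  case=> v [Pv v_free v_gen]; exists v; split=> [i|c /lcsE|x [/lcsE Lx]].
  - by have [/lcsE ? /homogeneousE ?] := Pv i.
  - exact: v_free.
  by move/homogeneousE => hom_x; have [c /lcsE] := v_gen x (conj Lx hom_x);
    exists c.
move=> /dimE dim_k dim_h.
apply: (@dim_lcs_le F freealg _ letter charF0 xword_letter_span component
  component_xword m d k h) => // S /dim_h/dimE.
exact.
Qed.

End FreeAlgebra.

(** * Counting short sets and bounding the densities *)

Lemma card_short_le n :
  (#|@short 'I_n| <= 'C(n, 1) + 'C(n, 2) + 'C(n, 3))%N.
Proof.
pose D k := [set S : {set 'I_n} | #|S| == k].
have cardD k : #|D k| = 'C(n, k) by rewrite card_draws card_ord.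
rewrite -!cardD; apply: leq_trans (leq_trans (leq_card_setU _ _) (leq_add
  (leq_card_setU _ _) (leqnn _))).
apply: subset_leq_card; apply/subsetP => S; rewrite !inE unfold_in /short.
by case: #|S| => [|[|[|[|]]]].
Qed.

Theorem corollary1p7 (F : fieldType) (charF0 : [pchar F] =i pred0)
    (n m : nat) (m_ge2 : (2 <= m)%N) (a a' : rat)
    (density_a : is_density F n m a) (density_a' : is_density F n m.+1 a') :
  [/\ n = 2%N -> a' <= 3%:R * a,
      n = 3%N -> a' <= 9%:R * a
    & (4 <= n)%N -> a' <= (n%:R ^+ 3 + 11%:R * n%:R) / 6%:R * a].
Proof.
case: density_a density_a' => p [sz_p [d0 p_dim]] ->
  [p' [sz_p' [d0' p'_dim]] ->].
case: n => [|n] in sz_p p_dim sz_p' p'_dim *.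
  by split; discriminate.
have lp_ge0 : 0 <= lead_coef p.
  by apply: (@lead_coef_ge0 _ _ d0) => d /p_dim[k _ ->]; apply: ler0n.
have le_lp : lead_coef p' <= lead_coef p *+ #|@short 'I_n.+1|.
  (* This threshold ensures d >= d0', d > 2 and d - #|S| >= d0, as #|S| <= 3. *)
  apply: (@lead_coef_shift_le _ n p p' (d0 + d0' + 3)%N _ _ (fun S : {set
    'I_n.+1} => #|S|) 3) => //.
    by move=> S /andP[].
  move=> d le_d; have [|k dim_k ->] := p'_dim d; first lia.
  have /fin_all_exists[h hP] (S : {set 'I_n.+1}) : exists k, short S ->
      dim_B F n.+1 m (d - #|S|) k /\ p.[(d - #|S|)%:R] = k%:R.
    case: (boolP (short S)) => [/andP[_ S_le3]|_]; last by exists 0%N.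
    by have [|k' dim_k' pk'] := p_dim (d - #|S|)%N; [lia|exists k'].
  under eq_bigr => S shS do rewrite (hP S shS).2.
  rewrite -natr_sum ler_nat; apply: dim_B_le dim_k _ => //; first lia.
  by move=> S /hP[].
have le_a c : ('C(n.+1, 1) + 'C(n.+1, 2) + 'C(n.+1, 3))%:R <= c ->
    lead_coef p' * n`!%:R <= c * (lead_coef p * n`!%:R).
  move=> le_c; rewrite mulrA ler_wpM2r ?ler0n //.
  apply: le_trans le_lp _; rewrite -mulr_natl ler_wpM2r //.
  by apply: le_trans le_c; rewrite ler_nat card_short_le.
(* For n generators the sum of binomials is (n^3 + 5 n) / 6: it is 3 for n = 2, 7 for n = 3, and at
   most (n^3 + 11 n) / 6 always. *)
split=> [[n1]|[n2]|_]; apply: le_a; rewrite ?n1 ?n2 ?ler_nat //.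
rewrite ler_pdivlMr ?ltr0n // -natrX -!natrM -natrD ler_nat.
have bin2n : ('C(n.+1, 2) * 2 = n.+1 * n)%N by rewrite (bin_ffact _ 2)
  !ffactnS ffactn0 muln1.
have bin3n : ('C(n.+1, 3) * 6 = n.+1 * (n * n.-1))%N.
  by rewrite (bin_ffact _ 3) !ffactnS ffactn0 muln1.
move: ('C(_, 2)) ('C(_, 3)) bin2n bin3n => c2 c3;
  rewrite bin1 !expnS expn0 muln1.
by case: (n) => [|k] /=; nia.
Qed.
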